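(* Fix $a,b,c\in\{0,1\}$ and consider $\beta$-reduction $\to$ on $abc$-infinitary $\lambda$-terms. For all $abc$-infinitary $\lambda$-terms $s,t$: $s\twoheadrightarrow^\infty t$ (there is a strongly converging $\beta$-reduction sequence of some ordinal length from $s$ to $t$) if and only if there is an ordinal $\gamma<\omega_1$ with $s\twoheadrightarrow_\gamma t$.
   Context: Fix $a,b,c\in\{0,1\}$ and a countable set of variables. $abc$-infinitary $\lambda$-terms are the possibly infinite terms generated by $x\mid \lambda x.s\mid st$ such that every infinite branch passes infinitely often through a body of an abstraction when $a=1$, a function part of an application when $b=1$, or an argument of an application when $c=1$ (i.e. through ''coinductive'' positions, the body of $\lambda$ being coinductive iff $a=1$, the function part iff $b=1$, the argument iff $c=1$); terms are taken modulo $\alpha$-equivalence and $s[t/x]$ is capture-avoiding substitution. Truncation: $s|_0=\ast$, $x|_{d+1}=x$, $(\lambda x.s)|_{d+1}=\lambda x.(s|_{d+1-a})$, $(st)|_{d+1}=(s|_{d+1-b})(t|_{d+1-c})$; metric $\mathrm{dist}(s,t)=\inf\{2^{-d}:s|_d=t|_d\}$. $\beta$-reduction with depths is defined inductively: $(\lambda x.s)t\to^{0}s[t/x]$; if $u\to^d u'$ then $\lambda x.u\to^{d+a}\lambda x.u'$, $uv\to^{d+b}u'v$; if $v\to^d v'$ then $uv\to^{d+c}uv'$. $\to^*$ is the reflexive transitive closure. A sequence $(s_\delta)_{\delta\le\gamma}$ with steps $s_\delta\to^{d_\delta}s_{\delta+1}$ ($\delta<\gamma$) is strongly converging if for every limit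 $\lambda\le\gamma$, $s_\delta\to s_\lambda$ in the metric and $d_\delta\to\infty$ as $\delta\to\lambda$; $s\twoheadrightarrow^\infty t$ if such a sequence exists from $s$ to $t$. For every ordinal $\gamma$ (by well-founded induction on $\gamma$), relations $\twoheadrightarrow_\gamma$ and $\overline{\twoheadrightarrow}_\gamma$ are defined by: (split) $s\twoheadrightarrow_\gamma t$ if there are $m\in\mathbb N$ and $s'$ with $s\rightsquigarrow^\gamma_m s'$ and $s'\overline{\twoheadrightarrow}_\gamma t$, where $s\rightsquigarrow^\gamma_m s'$ means there are ordinals $\delta_1,\dots,\delta_m<\gamma$ and terms with $s\to^*s_1'\overline{\twoheadrightarrow}_{\delta_1}t_1\to^*\cdots\overline{\twoheadrightarrow}_{\delta_m}t_m\to^*s'$ (for $m=0$: $s\to^*s'$); (lift$_x$) $x\,\overline{\twoheadrightarrow}_\gamma\,x$; (lift$_\lambda$) $\lambda x.u\,\overline{\twoheadrightarrow}_\gamma\,\lambda x.u'$ if $u\twoheadrightarrow_\gamma u'$, this premiss being coinductive iff $a=1$; (lift$_@$) $uv\,\overline{\twoheadrightarrow}_\gamma\,u'v'$ if $u\twoheadrightarrow_\gamma u'$ (coinductive iff $b=1$) and $v\twoheadrightarrow_\gamma v'$ (coinductive iff $c=1$). Derivations may be non-wellfounded provided every infinite branch crosses infinitely many coinductive premisses. *)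

(* Defs.v *)
From Stdlib Require Import Reals Arith Wellfounded FunctionalExtensionality.
From Coquelicot Require Import Rbar Lub.

Local Open Scope nat_scope.

(** * Terms *)

(** Terms modulo alpha-equivalence are represented with de Bruijn indices:
    [Lam] binds index 0 and the free variables are the indices that point
    beyond all the enclosing binders.  The type [V] of variables is a parameter
    only because truncated terms, which contain the constant [*], are trees
    over [option nat] (see [trunc]). *)

CoInductive tree (V : Type) : Type :=
| Var (x : V)
| Lam (u : tree V)
| App (u v : tree V).

Arguments Var {V} x.
Arguments Lam {V} u.
Arguments App {V} u v.

Notation raw_term := (tree nat).

(** Equality of possibly infinite trees; Leibniz equality is too fine on a
    coinductive type. *)
CoInductive bisim {V : Type} : tree V -> tree V -> Prop :=
| bisim_var x : bisim (Var x) (Var x)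
| bisim_lam u u' : bisim u u' -> bisim (Lam u) (Lam u')
| bisim_app u u' v v' : bisim u u' -> bisim v v' -> bisim (App u v) (App u' v').

Inductive dir : Type := Body | Fun | Arg.

Inductive child : dir -> raw_term -> raw_term -> Prop :=
| child_body u : child Body (Lam u) u
| child_fun u v : child Fun (App u v) u
| child_arg u v : child Arg (App u v) v.

Definition coinductive_dir (a b c : bool) (p : dir) : bool :=
  match p with Body => a | Fun => b | Arg => c end.

Definition infinite_branch (s : raw_term) (r : nat -> raw_term) (p : nat -> dir)
    : Prop :=
  r 0 = s /\ forall n, child (p n) (r n) (r (S n)).

Definition abc_term (a b c : bool) (s : raw_term) : Prop :=
  forall r p, infinite_branch s r p ->
  forall n, exists m, n <= m /\ coinductive_dir a b c (p m) = true.

(** * Substitution *)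

Definition up_ren (xi : nat -> nat) (n : nat) : nat :=
  match n with 0 => 0 | S k => S (xi k) end.

CoFixpoint rename (xi : nat -> nat) (s : raw_term) : raw_term :=
  match s with
  | Var x => Var (xi x)
  | Lam u => Lam (rename (up_ren xi) u)
  | App u v => App (rename xi u) (rename xi v)
  end.

Definition up (sigma : nat -> raw_term) (n : nat) : raw_term :=
  match n with 0 => Var 0 | S k => rename S (sigma k) end.

CoFixpoint subst (sigma : nat -> raw_term) (s : raw_term) : raw_term :=
  match s with
  | Var x => sigma x
  | Lam u => Lam (subst (up sigma) u)
  | App u v => App (subst sigma u) (subst sigma v)
  end.

(** [subst0 s t] is the contractum [s[t/x]] of the redex [(\x.s) t]: index 0 is
    replaced by [t] and, the binder having disappeared, the other free indices
    are decremented. *)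
Definition subst0 (s t : raw_term) : raw_term :=
  subst (fun n => match n with 0 => t | S k => Var k end) s.

(** * Truncation and metric *)

(** The constant [*] is [Var None]; a genuine variable [x] is [Var (Some x)]. *)
CoFixpoint trunc (a b c : bool) (d : nat) (s : raw_term) : tree (option nat) :=
  match d with
  | 0 => Var None
  | S _ =>
      match s with
      | Var x => Var (Some x)
      | Lam u => Lam (trunc a b c (d - Nat.b2n a) u)
      | App u v =>
          App (trunc a b c (d - Nat.b2n b) u) (trunc a b c (d - Nat.b2n c) v)
      end
  end.

(** The infimum is over a subset of [[0, 1]] containing 1 (take [d = 0]), so the
    projection [real] from the extended reals loses nothing. *)
Definition dist (a b c : bool) (s t : raw_term) : R :=
  real (Glb_Rbar (fun r : R => exists d : nat,
    r = ((/ 2) ^ d)%R /\ bisim (trunc a b c d s) (trunc a b c d t))).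

(** * Beta-reduction *)

(** [step_bisim] makes the relation one on terms up to [bisim]. *)
Inductive step (a b c : bool) : nat -> raw_term -> raw_term -> Prop :=
| step_beta s t : step a b c 0 (App (Lam s) t) (subst0 s t)
| step_lam d u u' :
    step a b c d u u' -> step a b c (d + Nat.b2n a) (Lam u) (Lam u')
| step_fun d u u' v :
    step a b c d u u' -> step a b c (d + Nat.b2n b) (App u v) (App u' v)
| step_arg d u v v' :
    step a b c d v v' -> step a b c (d + Nat.b2n c) (App u v) (App u v')
| step_bisim d s s' t t' :
    bisim s s' -> step a b c d s' t' -> bisim t' t -> step a b c d s t.

(** Reflexive transitive closure of beta-reduction on abc-infinitary terms. *)
Inductive steps (a b c : bool) : raw_term -> raw_term -> Prop :=
| steps_refl s t : abc_term a b c s -> bisim s t -> steps a b c s t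
| steps_cons d s s' t :
    abc_term a b c s -> step a b c d s s' -> steps a b c s' t -> steps a b c s t.

(** * Ordinals *)

(** An ordinal is given by an element [g] of some well-ordered type: it is the
    order type of the initial segment [{d | d < g}]. *)
Record wellOrder : Type := WellOrder {
  carrier :> Type;
  olt : carrier -> carrier -> Prop;
  olt_wf : well_founded olt;
  olt_trans : forall x y z, olt x y -> olt y z -> olt x z;
  olt_total : forall x y, olt x y \/ x = y \/ olt y x
}.

Arguments olt {w} x y.

Definition ole {W : wellOrder} (x y : W) : Prop := olt x y \/ x = y.

Definition is_zero {W : wellOrder} (x : W) : Prop := forall y, ~ olt y x.

Definition is_succ {W : wellOrder} (x y : W) : Prop :=
  olt x y /\ forall z, olt x z -> ole y z.

Definition is_limit {W : wellOrder} (l : W) : Prop :=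
  ~ is_zero l /\ forall x, ~ is_succ x l.

(** The ordinals below [omega_1] are the countable ones. *)
Definition below_omega1 {W : wellOrder} (g : W) : Prop :=
  exists f : W -> nat,
  forall x y, olt x g -> olt y g -> f x = f y -> x = y.

(** * Strongly converging reduction sequences *)

(** The sequence is indexed by the [x <= g]; [D x] is the depth of the step from
    [T x] to its successor.  Values of [T] beyond [g], and of [D] from [g] on,
    are irrelevant. *)
Record strongly_converging (a b c : bool) {W : wellOrder} (g : W)
    (T : W -> raw_term) (D : W -> nat) : Prop := {
  sc_term : forall x, ole x g -> abc_term a b c (T x);
  sc_step : forall x y, olt x g -> is_succ x y -> step a b c (D x) (T x) (T y);
  sc_limit : forall l, ole l g -> is_limit l ->
    forall eps : R, (0 < eps)%R ->
    exists x0, olt x0 l /\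
      forall x, ole x0 x -> olt x l -> (dist a b c (T x) (T l) < eps)%R;
  sc_depth : forall l, ole l g -> is_limit l ->
    forall N : nat,
    exists x0, olt x0 l /\ forall x, ole x0 x -> olt x l -> N <= D x
}.

Definition sc_red (a b c : bool) (s t : raw_term) : Prop :=
  exists (W : wellOrder) (o g : W) (T : W -> raw_term) (D : W -> nat),
    strongly_converging a b c g T D /\
    is_zero o /\ bisim s (T o) /\ bisim (T g) t.

(** * The ordinal-indexed relations *)

Definition trel : Type := raw_term -> raw_term -> Prop.

(** [prefix lo m s s'] where [lo] stands for the union, over the ordinals
    [d < g], of the barred relations of index [d].  All the terms involved
    are abc-infinitary, since each one is an endpoint of some [steps]. *)
Inductive prefix (a b c : bool) (lo : trel) : nat -> trel :=
| prefix_nil s s' : steps a b c s s' -> prefix a b c lo 0 s s'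
| prefix_cons m s s1 t1 s' :
    steps a b c s s1 -> lo s1 t1 -> prefix a b c lo m t1 s' ->
    prefix a b c lo (S m) s s'.

(** The rules, with [X] in place of the coinductive premisses; the remaining
    premisses are inductive. *)
Inductive red_rules (a b c : bool) (lo X : trel) : trel :=
| split m s s' t :
    prefix a b c lo m s s' -> lift_rules a b c lo X s' t ->
    red_rules a b c lo X s t
with lift_rules (a b c : bool) (lo X : trel) : trel :=
| lift_var x : lift_rules a b c lo X (Var x) (Var x)
| lift_lam u u' :
    (a = true -> X u u') -> (a = false -> red_rules a b c lo X u u') ->
    lift_rules a b c lo X (Lam u) (Lam u')
| lift_app u u' v v' :
    (b = true -> X u u') -> (b = false -> red_rules a b c lo X u u') ->
    (c = true -> X v v') -> (c = false -> red_rules a b c lo X v v') ->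
    lift_rules a b c lo X (App u v) (App u' v').

(** Greatest fixed point in [X] of the least fixed points above: derivations
    may be infinite, but between two crossings of a coinductive premiss only
    finitely many inductive ones can be crossed. *)
Definition red_at (a b c : bool) (lo : trel) : trel := fun s t =>
  exists X : trel,
    (forall u v, X u v -> red_rules a b c lo X u v) /\ X s t.

Definition lift_at (a b c : bool) (lo : trel) : trel :=
  lift_rules a b c lo (red_at a b c lo).

(** The barred relation of index [g], by well-founded induction on [g]. *)
Definition lifted (a b c : bool) {W : wellOrder} : W -> trel :=
  Fix (olt_wf W) (fun _ => trel)
    (fun g (rec : forall d, olt d g -> trel) =>
       lift_at a b c (fun s t => exists (d : W) (h : olt d g), rec d h s t)).

Definition red (a b c : bool) {W : wellOrder} (g : W) : trel :=
  red_at a b c (fun s t => exists d : W, olt d g /\ lifted a b c d s t).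

Lemma prefix_mono a b c (lo lo' : trel) :
  (forall s t, lo s t -> lo' s t) ->
  forall m s t, prefix a b c lo m s t -> prefix a b c lo' m s t.
Proof. induction 2; econstructor; eauto. Qed.

Scheme red_rules_mind := Induction for red_rules Sort Prop
with lift_rules_mind := Induction for lift_rules Sort Prop.
Combined Scheme red_lift_rules_ind from red_rules_mind, lift_rules_mind.

Lemma rules_mono a b c (lo lo' X X' : trel) :
  (forall s t, lo s t -> lo' s t) -> (forall s t, X s t -> X' s t) ->
  (forall s t, red_rules a b c lo X s t -> red_rules a b c lo' X' s t) /\
  (forall s t, lift_rules a b c lo X s t -> lift_rules a b c lo' X' s t).
Proof.
  intros Hlo HX.
  enough (H : (forall s t (_ : red_rules a b c lo X s t), red_rules a b c lo' X' s t) /\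
              (forall s t (_ : lift_rules a b c lo X s t), lift_rules a b c lo' X' s t))
    by exact H.
  apply red_lift_rules_ind; intros; econstructor; eauto using prefix_mono.
Qed.

Lemma red_at_mono a b c (lo lo' : trel) :
  (forall s t, lo s t -> lo' s t) ->
  forall s t, red_at a b c lo s t -> red_at a b c lo' s t.
Proof.
  intros Hlo s t (X & HX & H); exists X; split; [|exact H].
  intros u v Huv; apply (rules_mono a b c lo lo' X X); auto.
Qed.

Lemma red_atE a b c lo s t :
  red_at a b c lo s t <-> red_rules a b c lo (red_at a b c lo) s t.
Proof.
  assert (H : forall s t, red_at a b c lo s t ->
                red_rules a b c lo (red_at a b c lo) s t).
  { intros u v (X & HX & Huv).
    apply (rules_mono a b c lo lo X (red_at a b c lo)); auto.
    intros u' v' H'; exists X; auto. }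
  split; [apply H|]; intros Hst.
  exists (red_rules a b c lo (red_at a b c lo)); split; [|exact Hst].
  intros u v Huv.
  apply (rules_mono a b c lo lo (red_at a b c lo)
           (red_rules a b c lo (red_at a b c lo))); auto.
Qed.

Lemma lift_at_mono a b c (lo lo' : trel) :
  (forall s t, lo s t -> lo' s t) ->
  forall s t, lift_at a b c lo s t -> lift_at a b c lo' s t.
Proof.
  intros Hlo s t; unfold lift_at.
  apply rules_mono; [exact Hlo|].
  apply red_at_mono, Hlo.
Qed.

(** The intended recursion equation. *)
Lemma liftedE a b c {W : wellOrder} (g : W) s t :
  lifted a b c g s t <->
  lift_at a b c (fun s t => exists d : W, olt d g /\ lifted a b c d s t) s t.
Proof.
  unfold lifted at 1; rewrite Fix_eq.
  - split; apply lift_at_mono; intros u v (d & h & H); exists d.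
    + split; assumption.
    + exists h; exact H.
  - intros x rec rec' Hrec; replace rec' with rec; [reflexivity|].
    extensionality d; extensionality h; apply Hrec.
Qed.

(* Main.v *)
From Stdlib Require Import Reals Lra Lia Arith Cantor List Wellfounded.
From Stdlib Require Import Classical ClassicalEpsilon.
From Coquelicot Require Import Rbar Lub.
Require Import Defs.

Local Open Scope nat_scope.

(** From a converging sequence to [red]: by induction on its length [g], since
    only finitely many steps occur at the root, everything up to the last one,
    at position [w < g], is a reduction of index [w] followed by one step; what
    remains splits into sequences of length at most [g] between the immediate
    subterms.  Inductive premisses are crossed finitely often because they
    descend into the final term.  The length is countable because only finitely
    many steps have depth at most [n], for each [n].

    From [red] to a converging sequence: a derivation cut at depth [d] gives a
    term that agrees with the target down to depth [d], and moving the cut from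
    [d] to [d + 1] takes a reduction of depth at least [d].  The concatenation
    of these [omega] many reductions converges.  It is built with steps that may
    stutter, and the stuttering is removed at the end. *)

Lemma bisim_coind {V : Type} (P : tree V -> tree V -> Prop) :
  (forall s t, P s t ->
     match s, t with
     | Var x, Var y => x = y
     | Lam u, Lam u' => P u u'
     | App u v, App u' v' => P u u' /\ P v v'
     | _, _ => False
     end) ->
  forall s t, P s t -> bisim s t.
Proof.
  intros HP; cofix IH; intros s t H; apply HP in H.
  destruct s, t; try contradiction.
  - subst; constructor.
  - constructor; apply IH; exact H.
  - destruct H; constructor; apply IH; assumption.
Qed.

Lemma bisim_refl {V : Type} (s : tree V) : bisim s s.
Proof.
  apply (bisim_coind eq); [|reflexivity].
  intros ? t ->; destruct t; auto.
Qed.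

Lemma bisim_sym {V : Type} (s t : tree V) : bisim s t -> bisim t s.
Proof.
  intros H; apply (bisim_coind (fun t s => bisim s t)); [|exact H].
  intros ? ? []; auto.
Qed.

Lemma bisim_trans {V : Type} (s t u : tree V) :
  bisim s t -> bisim t u -> bisim s u.
Proof.
  intros H1 H2.
  apply (bisim_coind (fun s u => exists t, bisim s t /\ bisim t u)); [|eauto].
  intros s' u' (t' & H1' & H2'); destruct H1'; inversion H2'; subst; simpl; eauto 7.
Qed.

Definition unfold_tree {V : Type} (s : tree V) : tree V :=
  match s with Var x => Var x | Lam u => Lam u | App u v => App u v end.

Lemma unfold_treeE {V : Type} (s : tree V) : s = unfold_tree s.
Proof. destruct s; reflexivity. Qed.

Section Terms.

Context (a b c : bool).

Notation nba := (Nat.b2n a).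
Notation nbb := (Nat.b2n b).
Notation nbc := (Nat.b2n c).

Definition eqd (d : nat) (s t : raw_term) : Prop :=
  bisim (trunc a b c d s) (trunc a b c d t).

Lemma truncE d s :
  trunc a b c d s =
  match d with
  | 0 => Var None
  | S _ =>
      match s with
      | Var x => Var (Some x)
      | Lam u => Lam (trunc a b c (d - nba) u)
      | App u v => App (trunc a b c (d - nbb) u) (trunc a b c (d - nbc) v)
      end
  end.
Proof.
  rewrite (unfold_treeE (trunc a b c d s)); destruct d, s; reflexivity.
Qed.

Lemma eqd_refl d s : eqd d s s.
Proof. apply bisim_refl. Qed.

Lemma eqd_sym d s t : eqd d s t -> eqd d t s.
Proof. apply bisim_sym. Qed.

Lemma eqd_trans d s t u : eqd d s t -> eqd d t u -> eqd d s u.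
Proof. apply bisim_trans. Qed.

Lemma eqd_0 s t : eqd 0 s t.
Proof. unfold eqd; rewrite !truncE; constructor. Qed.

Lemma eqd_lam d u u' : eqd (d - nba) u u' -> eqd d (Lam u) (Lam u').
Proof.
  intros H; destruct d as [|d]; [apply eqd_0|].
  unfold eqd; rewrite (truncE _ (Lam u)), (truncE _ (Lam u')).
  constructor; exact H.
Qed.

Lemma eqd_app d u u' v v' :
  eqd (d - nbb) u u' -> eqd (d - nbc) v v' -> eqd d (App u v) (App u' v').
Proof.
  intros H1 H2; destruct d as [|d]; [apply eqd_0|].
  unfold eqd; rewrite (truncE _ (App u v)), (truncE _ (App u' v')).
  constructor; assumption.
Qed.

Lemma eqd_S_inv d s t : eqd (S d) s t ->
  match s, t with
  | Var x, Var y => x = y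
  | Lam u, Lam u' => eqd (S d - nba) u u'
  | App u v, App u' v' => eqd (S d - nbb) u u' /\ eqd (S d - nbc) v v'
  | _, _ => False
  end.
Proof.
  unfold eqd; rewrite (truncE _ s), (truncE _ t).
  destruct s, t; intros H; inversion H; auto.
Qed.

Lemma eqd_pred d s t : eqd (S d) s t -> eqd d s t.
Proof.
  intros H; apply (bisim_coind (fun p q => exists d s t, eqd (S d) s t /\
    p = trunc a b c d s /\ q = trunc a b c d t)); [|eauto 7].
  clear; intros ? ? (d & s & t & H & -> & ->).
  rewrite (truncE _ s), (truncE _ t); destruct d as [|d]; [reflexivity|].
  apply eqd_S_inv in H; destruct s as [|u|u v], t as [|u'|u' v'];
    try contradiction.
  - subst; reflexivity.
  - exists (S d - nba), u, u'; split; [|auto].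
    replace (S (S d - nba)) with (S (S d) - nba) by (destruct a; simpl; lia).
    exact H.
  - destruct H; split.
    + exists (S d - nbb), u, u'; split; [|auto].
      replace (S (S d - nbb)) with (S (S d) - nbb) by (destruct b; simpl; lia).
      assumption.
    + exists (S d - nbc), v, v'; split; [|auto].
      replace (S (S d - nbc)) with (S (S d) - nbc) by (destruct c; simpl; lia).
      assumption.
Qed.

Lemma eqd_le d e s t : d <= e -> eqd e s t -> eqd d s t.
Proof. induction 1; auto using eqd_pred. Qed.

Lemma bisim_eqd d s t : bisim s t -> eqd d s t.
Proof.
  intros H; apply (bisim_coind (fun p q => exists d s t, bisim s t /\
    p = trunc a b c d s /\ q = trunc a b c d t)); [|eauto 7].
  clear; intros ? ? (d & s & t & H & -> & ->).
  rewrite (truncE _ s), (truncE _ t); destruct d as [|d]; [reflexivity|].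
  destruct H; repeat split; eauto 7.
Qed.

Lemma eqd_bisim s t : (forall d, eqd d s t) -> bisim s t.
Proof.
  apply (bisim_coind (fun s t => forall d, eqd d s t)); clear; intros s t H.
  assert (H' := fun d => eqd_S_inv d s t (H (S d))).
  destruct s as [|u|u v], t as [|u'|u' v']; try solve [apply (H' 0)].
  - intros d; apply eqd_le with (S d - nba); [destruct a; simpl; lia|apply H'].
  - split; intros d.
    + apply eqd_le with (S d - nbb); [destruct b; simpl; lia|apply H'].
    + apply eqd_le with (S d - nbc); [destruct c; simpl; lia|apply H'].
Qed.

Lemma dist_lt_eqd N s t : (dist a b c s t < (/ 2) ^ N)%R -> eqd N s t.
Proof.
  intros H; apply NNPP; intros HN.
  assert (Hlb : forall d, eqd d s t -> d < N).
  { intros d Hd; apply Nat.nle_gt; intros Hle; apply HN.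
    exact (eqd_le _ _ _ _ Hle Hd). }
  unfold dist in H.
  match type of H with (real (Glb_Rbar ?E) < _)%R =>
    destruct (Glb_Rbar_correct E) as [Hl Hg] end.
  revert H Hl Hg; destruct (Glb_Rbar _) as [r| |]; simpl; intros H Hl Hg.
  - assert (Hr := Hg (Finite ((/ 2) ^ N))); simpl in Hr.
    enough ((/ 2) ^ N <= r)%R by lra.
    apply Hr; intros x (d & -> & Hd); simpl.
    apply Hlb in Hd.
    replace N with (d + (N - d)) by lia; rewrite pow_add.
    rewrite <- (Rmult_1_r ((/ 2) ^ d)) at 2.
    apply Rmult_le_compat_l; [apply pow_le; lra|].
    rewrite <- (pow1 (N - d)); apply pow_incr; lra.
  - apply (Hl 1%R); exists 0; split; [reflexivity|apply eqd_0].
  - apply (Hg (Finite 0)); intros x (d & -> & _); simpl.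
    apply pow_le; lra.
Qed.

Lemma eqd_dist_le N s t : eqd N s t -> (dist a b c s t <= (/ 2) ^ N)%R.
Proof.
  intros H; unfold dist.
  match goal with |- (real (Glb_Rbar ?E) <= _)%R =>
    destruct (Glb_Rbar_correct E) as [Hl Hg] end.
  assert (HN := Hl ((/ 2) ^ N)%R (ex_intro _ N (conj eq_refl H))).
  revert HN Hl Hg; destruct (Glb_Rbar _) as [r| |]; simpl; intros HN Hl Hg.
  - exact HN.
  - contradiction.
  - apply pow_le; lra.
Qed.

Lemma step_eqd d s t : step a b c d s t -> eqd d s t.
Proof.
  induction 1.
  - apply eqd_0.
  - apply eqd_lam; rewrite Nat.add_sub; assumption.
  - apply eqd_app; [rewrite Nat.add_sub; assumption|apply eqd_refl].
  - apply eqd_app; [apply eqd_refl|rewrite Nat.add_sub; assumption].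
  - eauto using eqd_trans, bisim_eqd.
Qed.

Inductive inner_step : nat -> raw_term -> raw_term -> Prop :=
| inner_lam d u u' :
    step a b c d u u' -> inner_step (d + nba) (Lam u) (Lam u')
| inner_fun d u u' v v' :
    step a b c d u u' -> bisim v v' -> inner_step (d + nbb) (App u v) (App u' v')
| inner_arg d u u' v v' :
    bisim u u' -> step a b c d v v' -> inner_step (d + nbc) (App u v) (App u' v').

Lemma step_inner d s t : step a b c d s t -> d = 0 \/ inner_step d s t.
Proof.
  induction 1 as [| | | |d s s' t t' Hs H [IH|IH] Ht].
  - left; reflexivity.
  - right; constructor; assumption.
  - right; constructor; auto using bisim_refl.
  - right; constructor; auto using bisim_refl.
  - left; exact IH.
  - right; destruct IH; inversion Hs; inversion Ht; subst;
      econstructor; eauto using bisim_trans, step_bisim.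
Qed.

Lemma abc_child p s u : abc_term a b c s -> child p s u -> abc_term a b c u.
Proof.
  intros Hs Hc r q [Hr Hq] n.
  destruct (Hs (fun n => match n with 0 => s | S k => r k end)
               (fun n => match n with 0 => p | S k => q k end)) with (n := S n)
    as (m & Hm & H).
  - split; [reflexivity|]; intros [|k]; [rewrite Hr; exact Hc|apply Hq].
  - destruct m as [|m]; [lia|]; exists m; split; [lia|exact H].
Qed.

Lemma abc_intro s :
  (forall p u, child p s u -> abc_term a b c u) -> abc_term a b c s.
Proof.
  intros H r p [Hr Hp] n.
  destruct (H (p 0) (r 1)) with (r := fun n => r (S n)) (p := fun n => p (S n))
    (n := n) as (m & Hm & Hd).
  - rewrite <- Hr; apply Hp.
  - split; auto.
  - exists (S m); auto.
Qed.

Lemma abc_lam u : abc_term a b c (Lam u) <-> abc_term a b c u.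
Proof.
  split; intros H.
  - apply (abc_child Body (Lam u)); [exact H|constructor].
  - apply abc_intro; intros p w Hw; inversion Hw; subst; exact H.
Qed.

Lemma abc_app u v :
  abc_term a b c (App u v) <-> abc_term a b c u /\ abc_term a b c v.
Proof.
  split; intros H.
  - split; [apply (abc_child Fun (App u v))|apply (abc_child Arg (App u v))];
      auto; constructor.
  - apply abc_intro; intros p w Hw; inversion Hw; subst; apply H.
Qed.

Definition inductive_child (u s : raw_term) : Prop :=
  exists p, coinductive_dir a b c p = false /\ child p s u.

Lemma abc_acc s : abc_term a b c s -> Acc inductive_child s.
Proof.
  intros Hs; apply NNPP; intros Hn.
  assert (Hnext : forall w : {u | ~ Acc inductive_child u},
    exists q : dir * {u | ~ Acc inductive_child u},
      coinductive_dir a b c (fst q) = false /\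
      child (fst q) (proj1_sig w) (proj1_sig (snd q))).
  { intros [u Hu]; apply NNPP; intros H; apply Hu; constructor.
    intros v (p & Hp & Hc); apply NNPP; intros Hv; apply H.
    exists (p, exist _ v Hv); auto. }
  pose (next w := proj1_sig (constructive_indefinite_description _ (Hnext w))).
  assert (HN : forall w, coinductive_dir a b c (fst (next w)) = false /\
      child (fst (next w)) (proj1_sig w) (proj1_sig (snd (next w)))).
  { intros w; exact (proj2_sig (constructive_indefinite_description _ (Hnext w))). }
  pose (r := fix r n := match n with
                        | 0 => exist _ s Hn
                        | S k => snd (next (r k))
                        end).
  destruct (Hs (fun n => proj1_sig (r n)) (fun n => fst (next (r n))))
    with (n := 0) as (m & _ & Hm).
  - split; [reflexivity|]; intros n; apply (HN (r n)).
  - destruct (HN (r m)) as [H _]; congruence.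
Qed.

End Terms.

Section Orders.

Context {W : wellOrder}.
Implicit Types x y z : W.

Lemma olt_irrefl x : ~ olt x x.
Proof.
  induction (olt_wf W x) as [x _ IH]; intros H; exact (IH x H H).
Qed.

Lemma ole_refl x : ole x x.
Proof. right; reflexivity. Qed.

Lemma olt_ole x y : olt x y -> ole x y.
Proof. left; assumption. Qed.

Lemma ole_olt_trans x y z : ole x y -> olt y z -> olt x z.
Proof. intros [H| ->]; eauto using olt_trans. Qed.

Lemma olt_ole_trans x y z : olt x y -> ole y z -> olt x z.
Proof. intros H [H'| <-]; eauto using olt_trans. Qed.

Lemma ole_trans x y z : ole x y -> ole y z -> ole x z.
Proof. intros H [H'| <-]; [left; eauto using ole_olt_trans|exact H]. Qed.

Lemma olt_or_ole x y : olt x y \/ ole y x.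
Proof. destruct (olt_total W x y) as [H|[H|H]]; unfold ole; auto. Qed.

Lemma olt_not_ole x y : olt x y -> ~ ole y x.
Proof. intros H H'; exact (olt_irrefl x (olt_ole_trans _ _ _ H H')). Qed.

Lemma ole_antisym x y : ole x y -> ole y x -> x = y.
Proof. intros [H|H] H'; [destruct (olt_not_ole _ _ H H')|exact H]. Qed.

Lemma exists_min (P : W -> Prop) x :
  P x -> exists y, P y /\ ole y x /\ forall z, P z -> ole y z.
Proof.
  induction (olt_wf W x) as [x _ IH]; intros Hx.
  destruct (classic (exists y, olt y x /\ P y)) as [(y & Hy & Py)|H].
  - destruct (IH y Hy Py) as (z & Hz & Hzy & Hm).
    exists z; split; [exact Hz|]; split; [|exact Hm].
    left; exact (ole_olt_trans _ _ _ Hzy Hy).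
  - exists x; split; [exact Hx|]; split; [apply ole_refl|]; intros z Hz.
    destruct (olt_or_ole z x) as [Hlt|Hle]; [|exact Hle].
    destruct H; eauto.
Qed.

Lemma exists_succ x g : olt x g -> exists y, is_succ x y /\ ole y g.
Proof.
  intros H; destruct (exists_min (olt x) g H) as (y & Hy & Hyg & Hm).
  exists y; split; [split|]; assumption.
Qed.

Lemma zero_succ_limit x : is_zero x \/ (exists y, is_succ y x) \/ is_limit x.
Proof.
  destruct (classic (is_zero x)) as [|H0]; [left; assumption|right].
  destruct (classic (exists y, is_succ y x)) as [|HS]; [left; assumption|right].
  split; [exact H0|]; intros y Hy; apply HS; exists y; exact Hy.
Qed.

Lemma is_succ_inj x y z : is_succ x y -> is_succ x z -> y = z.
Proof.
  intros [H1 H2] [H3 H4]; apply ole_antisym; auto.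
Qed.

Lemma succ_ole x y z : is_succ x y -> olt z y -> ole z x.
Proof.
  intros [_ H] Hzy; destruct (olt_or_ole x z) as [Hxz|Hle]; [|exact Hle].
  destruct (olt_not_ole _ _ Hzy (H z Hxz)).
Qed.

Lemma zero_ole o x : is_zero o -> ole o x.
Proof.
  intros Ho; destruct (olt_or_ole x o) as [H|H]; [destruct (Ho x H)|exact H].
Qed.

End Orders.

(** Like [strongly_converging], on the interval [[x, y]] and with the metric
    unfolded, but a step may also stutter: these sequences are stable under
    taking the immediate subterms when no step occurs at the root. *)
Record gseq (a b c : bool) {W : wellOrder} (x y : W)
    (T : W -> raw_term) (D : W -> nat) : Prop := {
  gs_term : forall z, ole x z -> ole z y -> abc_term a b c (T z);
  gs_step : forall z z', ole x z -> olt z y -> is_succ z z' ->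
    bisim (T z) (T z') \/ step a b c (D z) (T z) (T z');
  gs_limit : forall l, olt x l -> ole l y -> is_limit l -> forall N,
    exists z0, ole x z0 /\ olt z0 l /\
      forall z, ole z0 z -> olt z l -> eqd a b c N (T z) (T l) /\ N <= D z
}.

Lemma gseq_sub a b c {W : wellOrder} (x x' y y' : W) T D :
  gseq a b c x y T D -> ole x x' -> ole y' y -> gseq a b c x' y' T D.
Proof.
  intros [H1 H2 H3] Hx Hy; split.
  - intros z Hz Hz'; apply H1; eauto using ole_trans.
  - intros z z' Hz Hz' Hs; apply H2; eauto using ole_trans, olt_ole_trans.
  - intros l Hl Hly Hlim N.
    destruct (H3 l (ole_olt_trans _ _ _ Hx Hl) (ole_trans _ _ _ Hly Hy) Hlim N)
      as (z0 & Hz0 & Hz0l & H).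
    destruct (olt_or_ole z0 x') as [Hlt|Hle].
    + exists x'; repeat split; auto using ole_refl; apply H; auto.
      * eauto using ole_trans, olt_ole.
      * eauto using ole_trans, olt_ole.
    + exists z0; auto.
Qed.

(** Transfinite induction for properties of the [T z] that are closed under
    limits in the metric. *)
Lemma gseq_ind a b c {W : wellOrder} (x y : W) T D (P : raw_term -> Prop) d :
  gseq a b c x y T D -> P (T x) ->
  (forall z z', ole x z -> olt z y -> is_succ z z' -> P (T z) -> P (T z')) ->
  (forall u v, eqd a b c d u v -> P u -> P v) ->
  forall z, ole x z -> ole z y -> P (T z).
Proof.
  intros HT H0 HS HL z; induction (olt_wf W z) as [z _ IH]; intros Hxz Hzy.
  destruct Hxz as [Hxz| <-]; [|exact H0].
  destruct (zero_succ_limit z) as [Hz|[[w Hw]|Hz]].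
  - destruct (Hz x Hxz).
  - assert (Hxw := succ_ole _ _ _ Hw Hxz).
    assert (Hwy : olt w y) by (destruct Hw; eauto using olt_ole_trans).
    apply (HS w z Hxw Hwy Hw); apply IH; [apply Hw|exact Hxw|left; exact Hwy].
  - destruct (gs_limit _ _ _ _ _ _ _ HT z Hxz Hzy Hz d) as (z0 & Hx0 & H0z & H).
    apply (HL (T z0)); [apply H; auto using ole_refl|].
    apply IH; eauto using ole_trans, olt_ole.
Qed.

Section Forward.

Context (a b c : bool) {W : wellOrder} (T : W -> raw_term) (D : W -> nat).

Definition inner_at (z z' : W) : Prop :=
  bisim (T z) (T z') \/ inner_step a b c (D z) (T z) (T z').

Lemma last_root_step x y : ole x y -> gseq a b c x y T D ->
  (forall z z', ole x z -> olt z y -> is_succ z z' -> inner_at z z') \/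
  (exists w w', ole x w /\ olt w y /\ is_succ w w' /\
     step a b c (D w) (T w) (T w') /\
     forall z z', ole w' z -> olt z y -> is_succ z z' -> inner_at z z').
Proof.
  intros Hxy HT.
  destruct (exists_min (fun u => ole x u /\
    forall z z', ole u z -> olt z y -> is_succ z z' -> inner_at z z') y)
    as (u & [Hxu Hu] & Huy & Hmin).
  { split; [exact Hxy|]; intros z z' H1 H2; destruct (olt_not_ole _ _ H2 H1). }
  destruct (zero_succ_limit u) as [Hz|[[w Hw]|Hl]].
  - left; intros z z' _; apply Hu, zero_ole, Hz.
  - destruct Hxu as [Hxu| <-]; [|left; exact Hu].
    right; exists w, u.
    assert (Hxw := succ_ole _ _ _ Hw Hxu).
    assert (Hwy : olt w y) by (destruct Hw; eauto using olt_ole_trans).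
    repeat split; auto; try apply Hw.
    apply NNPP; intros Hn.
    apply (olt_not_ole w u); [apply Hw|]; apply Hmin; split; [exact Hxw|].
    intros z z' [Hz| ->] Hzy Hs.
    + apply Hu; auto; apply Hw; exact Hz.
    + destruct (gs_step _ _ _ _ _ _ _ HT z z' Hxw Hzy Hs) as [H|H];
        [left; exact H|].
      rewrite (is_succ_inj _ _ _ Hs Hw) in H; contradiction.
  - destruct Hxu as [Hxu| <-]; [|left; exact Hu].
    destruct (gs_limit _ _ _ _ _ _ _ HT u Hxu Huy Hl 1)
      as (z0 & Hx0 & H0u & H).
    exfalso; apply (olt_not_ole z0 u H0u); apply Hmin; split; [exact Hx0|].
    intros z z' Hz Hzy Hs; destruct (olt_or_ole z u) as [Hzu|Huz]; [|auto].
    destruct (gs_step _ _ _ _ _ _ _ HT z z' (ole_trans _ _ _ Hx0 Hz) Hzy Hs)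
      as [H'|H']; [left; exact H'|right].
    destruct (step_inner _ _ _ _ _ _ H') as [HD|Hi]; [|exact Hi].
    destruct (H z Hz Hzu) as [_ H1]; lia.
Qed.

Section Inner.

Context (x y : W) (Hxy : ole x y) (HT : gseq a b c x y T D).
Hypothesis Hinner :
  forall z z', ole x z -> olt z y -> is_succ z z' -> inner_at z z'.

Lemma inner_var n : T x = Var n -> T y = Var n.
Proof.
  intros H0; apply (gseq_ind _ _ _ _ _ _ _ (fun u => u = Var n) 1 HT);
    auto using ole_refl.
  - intros z z' Hz Hzy Hs Hn; destruct (Hinner z z' Hz Hzy Hs) as [H|H];
      rewrite Hn in H; inversion H; reflexivity.
  - intros u v Huv ->; apply eqd_S_inv in Huv; destruct v; try contradiction.
    congruence.
Qed.

Lemma inner_Lam u : T x = Lam u ->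
  forall z, ole x z -> ole z y -> exists w, T z = Lam w.
Proof.
  intros H0; apply (gseq_ind _ _ _ _ _ _ _ (fun u => exists w, u = Lam w) 1 HT).
  - eauto.
  - intros z z' Hz Hzy Hs [w Hw]; destruct (Hinner z z' Hz Hzy Hs) as [H|H];
      rewrite Hw in H; inversion H; eauto.
  - intros s t Hst [w ->]; apply eqd_S_inv in Hst; destruct t; try contradiction.
    eauto.
Qed.

Lemma inner_App u v : T x = App u v ->
  forall z, ole x z -> ole z y -> exists w w', T z = App w w'.
Proof.
  intros H0;
    apply (gseq_ind _ _ _ _ _ _ _ (fun u => exists w w', u = App w w') 1 HT).
  - eauto.
  - intros z z' Hz Hzy Hs (w & w' & Hw); destruct (Hinner z z' Hz Hzy Hs) as [H|H];
      rewrite Hw in H; inversion H; eauto.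
  - intros s t Hst (w & w' & ->); apply eqd_S_inv in Hst; destruct t;
      try contradiction; eauto.
Qed.

Definition body (s : raw_term) := match s with Lam u => u | _ => s end.
Definition fun_part (s : raw_term) := match s with App u _ => u | _ => s end.
Definition arg_part (s : raw_term) := match s with App _ v => v | _ => s end.

Lemma gseq_map (f : raw_term -> raw_term) k :
  (forall z, ole x z -> ole z y -> abc_term a b c (f (T z))) ->
  (forall z z', ole x z -> olt z y -> is_succ z z' ->
     bisim (f (T z)) (f (T z')) \/
     step a b c (D z - k) (f (T z)) (f (T z'))) ->
  (forall N z z', ole x z -> ole z y -> ole x z' -> ole z' y ->
     eqd a b c (S N + k) (T z) (T z') -> eqd a b c N (f (T z)) (f (T z'))) ->
  gseq a b c x y (fun z => f (T z)) (fun z => D z - k).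
Proof.
  intros Hf Hs Hl; split; auto.
  intros l Hxl Hly Hlim N.
  destruct (gs_limit _ _ _ _ _ _ _ HT l Hxl Hly Hlim (S N + k))
    as (z0 & Hx0 & H0l & H).
  exists z0; repeat split; auto.
  - apply Hl; try apply H; eauto using ole_trans, olt_ole, olt_ole_trans.
  - destruct (H z) as [_ HD]; auto; lia.
Qed.

Lemma gseq_body u : T x = Lam u ->
  gseq a b c x y (fun z => body (T z)) (fun z => D z - Nat.b2n a).
Proof.
  intros H0; assert (HL := inner_Lam u H0).
  apply gseq_map with (f := body).
  - intros z Hxz Hzy; assert (Hz := gs_term _ _ _ _ _ _ _ HT z Hxz Hzy).
    destruct (HL z Hxz Hzy) as [w Hw]; rewrite Hw in *.
    exact (proj1 (abc_lam _ _ _ _) Hz).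
  - intros z z' Hxz Hzy Hs; destruct (HL z Hxz (olt_ole _ _ Hzy)) as [w Hw].
    destruct (Hinner z z' Hxz Hzy Hs) as [H|H]; rewrite Hw in *; inversion H;
      simpl; rewrite ?Nat.add_sub; auto.
  - intros N z z' H1 H2 H3 H4 H; destruct (HL z H1 H2) as [w Hw].
    rewrite Hw in *; simpl plus in H; apply eqd_S_inv in H.
    destruct (T z'); try contradiction.
    eapply eqd_le; [|exact H]; lia.
Qed.

Lemma gseq_fun u v : T x = App u v ->
  gseq a b c x y (fun z => fun_part (T z)) (fun z => D z - Nat.b2n b).
Proof.
  intros H0; assert (HL := inner_App u v H0).
  apply gseq_map with (f := fun_part).
  - intros z Hxz Hzy; assert (Hz := gs_term _ _ _ _ _ _ _ HT z Hxz Hzy).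
    destruct (HL z Hxz Hzy) as (w & w' & Hw); rewrite Hw in *.
    exact (proj1 (proj1 (abc_app _ _ _ _ _) Hz)).
  - intros z z' Hxz Hzy Hs; destruct (HL z Hxz (olt_ole _ _ Hzy)) as (w & w' & Hw).
    destruct (Hinner z z' Hxz Hzy Hs) as [H|H]; rewrite Hw in *; inversion H;
      simpl; rewrite ?Nat.add_sub; auto.
  - intros N z z' H1 H2 H3 H4 H; destruct (HL z H1 H2) as (w & w' & Hw).
    rewrite Hw in *; simpl plus in H; apply eqd_S_inv in H.
    destruct (T z'); try contradiction.
    eapply eqd_le; [|apply H]; lia.
Qed.

Lemma gseq_arg u v : T x = App u v ->
  gseq a b c x y (fun z => arg_part (T z)) (fun z => D z - Nat.b2n c).
Proof.
  intros H0; assert (HL := inner_App u v H0).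
  apply gseq_map with (f := arg_part).
  - intros z Hxz Hzy; assert (Hz := gs_term _ _ _ _ _ _ _ HT z Hxz Hzy).
    destruct (HL z Hxz Hzy) as (w & w' & Hw); rewrite Hw in *.
    exact (proj2 (proj1 (abc_app _ _ _ _ _) Hz)).
  - intros z z' Hxz Hzy Hs; destruct (HL z Hxz (olt_ole _ _ Hzy)) as (w & w' & Hw).
    destruct (Hinner z z' Hxz Hzy Hs) as [H|H]; rewrite Hw in *; inversion H;
      simpl; rewrite ?Nat.add_sub; auto.
  - intros N z z' H1 H2 H3 H4 H; destruct (HL z H1 H2) as (w & w' & Hw).
    rewrite Hw in *; simpl plus in H; apply eqd_S_inv in H.
    destruct (T z'); try contradiction.
    eapply eqd_le; [|apply H]; lia.
Qed.

End Inner.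

End Forward.

Lemma prefix_snoc a b c lo m s s' t u :
  prefix a b c lo m s s' -> lo s' t -> steps a b c t u ->
  prefix a b c lo (S m) s u.
Proof.
  induction 1 as [s s' H|m s s1 t1 s' H H1 _ IH]; intros Hlo Htu.
  - econstructor; [exact H|exact Hlo|constructor; exact Htu].
  - econstructor; [exact H|exact H1|auto].
Qed.

Definition gseq_red (a b c : bool) {W : wellOrder} (g : W) : trel := fun s t =>
  abc_term a b c s /\ abc_term a b c t /\
  exists x T D, ole x g /\ gseq a b c x g T D /\ bisim s (T x) /\ bisim (T g) t.

Section ForwardRed.

Context (a b c : bool) {W : wellOrder} (g : W).

Lemma inner_lift_rules lo x T D v :
  ole x g -> gseq a b c x g T D ->
  (forall z z', ole x z -> olt z g -> is_succ z z' -> inner_at a b c T D z z') ->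
  bisim (T g) v -> abc_term a b c v ->
  (forall u' v', inductive_child a b c v' v -> gseq_red a b c g u' v' ->
     red_rules a b c lo (gseq_red a b c g) u' v') ->
  lift_rules a b c lo (gseq_red a b c g) (T x) v.
Proof.
  intros Hxg HT Hin Hv Hav Hind.
  assert (Hax := gs_term _ _ _ _ _ _ _ HT x (ole_refl x) Hxg).
  destruct (T x) as [n|u|u u'] eqn:Hx.
  - rewrite (inner_var _ _ _ _ _ _ _ Hxg HT Hin n Hx) in Hv.
    inversion Hv; constructor.
  - destruct (inner_Lam _ _ _ _ _ _ _ HT Hin u Hx g Hxg (ole_refl g))
      as [w Hw].
    rewrite Hw in Hv; inversion Hv as [|? v1 Hwv|]; subst v.
    assert (Hr : gseq_red a b c g u v1).
    { apply (proj1 (abc_lam _ _ _ _)) in Hav, Hax; split; [exact Hax|]; split; [exact Hav|].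
      exists x, (fun z => body (T z)), (fun z => D z - Nat.b2n a).
      split; [exact Hxg|]; split; [eapply gseq_body; eassumption|].
      rewrite Hx, Hw; auto using bisim_refl. }
    constructor; intros Ha; [exact Hr|].
    apply Hind; [exists Body; split; [exact Ha|constructor]|exact Hr].
  - destruct (inner_App _ _ _ _ _ _ _ HT Hin u u' Hx g Hxg (ole_refl g))
      as (w & w' & Hw).
    rewrite Hw in Hv; inversion Hv as [| |? v1 ? v2 Hwv Hwv']; subst v.
    apply abc_app in Hav, Hax; destruct Hav, Hax.
    assert (Hr : gseq_red a b c g u v1).
    { split; [assumption|]; split; [assumption|].
      exists x, (fun z => fun_part (T z)), (fun z => D z - Nat.b2n b).
      split; [exact Hxg|]; split; [eapply gseq_fun; eassumption|].
      rewrite Hx, Hw; auto using bisim_refl. }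
    assert (Hr' : gseq_red a b c g u' v2).
    { split; [assumption|]; split; [assumption|].
      exists x, (fun z => arg_part (T z)), (fun z => D z - Nat.b2n c).
      split; [exact Hxg|]; split; [eapply gseq_arg; eassumption|].
      rewrite Hx, Hw; auto using bisim_refl. }
    constructor; intros Hd; auto.
    + apply Hind; [exists Fun; split; [exact Hd|constructor]|exact Hr].
    + apply Hind; [exists Arg; split; [exact Hd|constructor]|exact Hr'].
Qed.

End ForwardRed.

Lemma gseq_red_red a b c {W : wellOrder} (g : W) s t :
  gseq_red a b c g s t -> red a b c g s t.
Proof.
  revert s t; induction (olt_wf W g) as [g _ IH]; intros s t Hst.
  exists (gseq_red a b c g); split; [|exact Hst]; clear s t Hst.
  intros s t Hst; assert (Hacc : Acc (inductive_child a b c) t).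
  { apply abc_acc, Hst. }
  revert s Hst; induction Hacc as [t _ IHt].
  intros s (Hs & Ht & x & T & D & Hxg & HT & Hsx & Hgt).
  destruct (last_root_step a b c T D x g Hxg HT)
    as [Hin|(w & w' & Hxw & Hwg & Hww' & Hstep & Hin)].
  - apply split with (m := 0) (s' := T x);
      [constructor; constructor; assumption|].
    eapply inner_lift_rules; eauto.
  - assert (Hw'g : ole w' g) by (apply Hww'; exact Hwg).
    assert (Hxw' : ole x w') by (left; eapply ole_olt_trans; [exact Hxw|apply Hww']).
    assert (Haw : abc_term a b c (T w)).
    { apply (gs_term _ _ _ _ _ _ _ HT); [exact Hxw|left; exact Hwg]. }
    assert (Hw : red a b c w s (T w)).
    { apply IH; [exact Hwg|]; split; [exact Hs|].
      split; [exact Haw|].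
      exists x, T, D; split; [exact Hxw|]; split; [|auto using bisim_refl].
      eapply gseq_sub; [exact HT|apply ole_refl|left; exact Hwg]. }
    apply red_atE in Hw; destruct Hw as [m s s' t' Hpre Hlift].
    apply split with (m := S m) (s' := T w').
    + eapply prefix_snoc.
      * eapply prefix_mono; [|exact Hpre].
        intros p q (d & Hd & H); exists d; eauto using olt_trans.
      * exists w; split; [exact Hwg|]; apply liftedE; exact Hlift.
      * eapply steps_cons; [|exact Hstep|apply steps_refl].
        -- exact Haw.
        -- apply (gs_term _ _ _ _ _ _ _ HT); auto.
        -- apply bisim_refl.
    + eapply inner_lift_rules; eauto.
      eapply gseq_sub; [exact HT|exact Hxw'|apply ole_refl].
Qed.

Lemma pow_half_lt (eps : R) : (0 < eps)%R -> exists N, ((/ 2) ^ N < eps)%R.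
Proof.
  intros H; destruct (pow_lt_1_zero (/ 2)) with (y := eps) as [N HN]; auto.
  - rewrite Rabs_pos_eq; lra.
  - exists N; specialize (HN N (le_n N)).
    rewrite Rabs_pos_eq in HN; [exact HN|apply pow_le; lra].
Qed.

Lemma strongly_converging_gseq a b c {W : wellOrder} (o g : W) T D :
  is_zero o -> strongly_converging a b c g T D -> gseq a b c o g T D.
Proof.
  intros Ho [H1 H2 H3 H4]; split.
  - auto.
  - auto.
  - intros l _ Hl Hlim N.
    destruct (H3 l Hl Hlim ((/ 2) ^ N)%R) as (x & Hx & Hx'); [apply pow_lt; lra|].
    destruct (H4 l Hl Hlim N) as (x' & Hx2 & Hx2').
    destruct (olt_or_ole x x') as [H|H]; [exists x'|exists x];
      repeat split; auto using zero_ole; try apply dist_lt_eqd;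
      eauto using ole_trans, olt_ole.
Qed.

Lemma finite_steps a b c {W : wellOrder} (g : W) T D n :
  strongly_converging a b c g T D ->
  exists L : list W, forall x, olt x g -> D x <= n -> In x L.
Proof.
  intros HT; assert (Hg := ole_refl g); revert Hg.
  generalize g at 1 3; intros y; induction (olt_wf W y) as [y _ IH]; intros Hy.
  destruct (zero_succ_limit y) as [Hz|[[w Hw]|Hl]].
  - exists nil; intros x Hx; destruct (Hz x Hx).
  - destruct (IH w) as [L HL]; [apply Hw|left; eapply olt_ole_trans; [apply Hw|exact Hy]|].
    exists (w :: L); intros x Hx Hn; destruct (succ_ole _ _ _ Hw Hx) as [Hlt| ->];
      [right; auto|left; reflexivity].
  - destruct (sc_depth _ _ _ _ _ _ HT y Hy Hl (S n)) as (x0 & Hx0 & H).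
    destruct (IH x0 Hx0) as [L HL]; [left; eauto using olt_ole_trans|].
    exists L; intros x Hx Hn; destruct (olt_or_ole x x0) as [Hlt|Hle]; [auto|].
    specialize (H x Hle Hx); lia.
Qed.

Lemma strongly_converging_countable a b c {W : wellOrder} (g : W) T D :
  strongly_converging a b c g T D -> below_omega1 g.
Proof.
  intros HT.
  pose (E n := constructive_indefinite_description _
                 (finite_steps a b c g T D n HT)).
  assert (HI : forall x, olt x g ->
    exists k, nth_error (proj1_sig (E (D x))) k = Some x).
  { intros x Hx; apply In_nth_error, (proj2_sig (E (D x))); auto. }
  assert (Hf : forall x, exists p, olt x g ->
    nth_error (proj1_sig (E (fst (Cantor.of_nat p)))) (snd (Cantor.of_nat p))
      = Some x).
  { intros x; destruct (classic (olt x g)) as [Hx|Hx].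
    - destruct (HI x Hx) as [k Hk]; exists (Cantor.to_nat (D x, k)); intros _.
      rewrite Cantor.cancel_of_to; exact Hk.
    - exists 0; contradiction. }
  exists (fun x => proj1_sig (constructive_indefinite_description _ (Hf x))).
  intros x y Hx Hy; do 2 destruct (constructive_indefinite_description _ _) as [? ?];
    simpl; intros ->.
  enough (Some x = Some y) by congruence; rewrite <- e, <- e0; auto.
Qed.

Lemma sc_red_red a b c s t :
  abc_term a b c s -> abc_term a b c t -> sc_red a b c s t ->
  exists (W : wellOrder) (g : W), below_omega1 g /\ red a b c g s t.
Proof.
  intros Hs Ht (W & o & g & T & D & HT & Ho & Hso & Hgt).
  exists W, g; split; [eapply strongly_converging_countable; exact HT|].
  apply gseq_red_red; split; [exact Hs|]; split; [exact Ht|].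
  exists o, T, D; auto using zero_ole, strongly_converging_gseq.
Qed.

Lemma abc_bisim a b c s t : bisim s t -> abc_term a b c s -> abc_term a b c t.
Proof.
  intros Hst Hs r p [Hr Hp].
  pose (f q u := match q with
                 | Body => body u | Fun => fun_part u | Arg => arg_part u
                 end).
  pose (r' := fix r' n := match n with 0 => s | S k => f (p k) (r' k) end).
  assert (Hr' : forall n, bisim (r' n) (r n)).
  { induction n as [|n IH]; [rewrite Hr; exact Hst|]; simpl.
    specialize (Hp n); destruct Hp; inversion IH; simpl; assumption. }
  apply (Hs r' p); split; [reflexivity|]; intros n; simpl.
  specialize (Hr' n); specialize (Hp n).
  destruct Hp; inversion Hr'; simpl; constructor.
Qed.

Section Backward.

Context (a b c : bool).

(** Strongly converging reduction in steps of depth at least [n], with the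
    length left implicit: besides single steps, convergent concatenations of
    [omega] many reductions suffice. *)
Inductive conv_red : nat -> trel :=
| conv_refl n s t :
    abc_term a b c s -> abc_term a b c t -> bisim s t -> conv_red n s t
| conv_step n d s t :
    n <= d -> abc_term a b c s -> abc_term a b c t -> step a b c d s t ->
    conv_red n s t
| conv_lim n (e : nat -> nat) (f : nat -> raw_term) t :
    (forall k, n <= e k) -> (forall k, conv_red (e k) (f k) (f (S k))) ->
    (forall N, exists K, forall k, K <= k -> N <= e k /\ eqd a b c N (f k) t) ->
    abc_term a b c t -> conv_red n (f 0) t.

Lemma conv_red_le m n s t : m <= n -> conv_red n s t -> conv_red m s t.
Proof.
  intros Hmn H; revert Hmn.
  destruct H as [n s t H1 H2 H3|n d s t H1 H2 H3 H4|n e f t H1 H2 H3 H4];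
    intros Hmn.
  - apply conv_refl; assumption.
  - apply conv_step with d; auto; lia.
  - apply conv_lim with (e := e); auto; intros k; specialize (H1 k); lia.
Qed.

Lemma conv_red_abc n s t :
  conv_red n s t -> abc_term a b c s /\ abc_term a b c t.
Proof.
  induction 1 as [| |n e f t _ _ IH _ Ht]; auto; split; [apply (IH 0)|exact Ht].
Qed.

Lemma conv_red_trans n s t u : conv_red n s t -> conv_red n t u -> conv_red n s u.
Proof.
  intros H1 H2; destruct (conv_red_abc _ _ _ H2) as [_ Hu].
  apply conv_lim with (e := fun k => n + (k - 1))
    (f := fun k => match k with 0 => s | 1 => t | _ => u end); auto; [lia|..].
  - intros [|[|k]]; simpl.
    + rewrite Nat.add_0_r; exact H1.
    + rewrite Nat.add_0_r; exact H2.
    + apply conv_refl; auto using bisim_refl.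
  - intros N; exists (N + 2); intros [|[|k]] Hk; try lia.
    split; [lia|apply eqd_refl].
Qed.

Lemma conv_red_lam n u u' :
  conv_red n u u' -> conv_red (n + Nat.b2n a) (Lam u) (Lam u').
Proof.
  induction 1 as [n u u' H1 H2 H3|n d u u' H1 H2 H3 H4|n e f u H1 _ IH H3 H4].
  - apply conv_refl; try apply abc_lam; auto; constructor; exact H3.
  - apply conv_step with (d + Nat.b2n a); try apply abc_lam; auto; [lia|].
    constructor; exact H4.
  - apply conv_lim with (e := fun k => e k + Nat.b2n a)
      (f := fun k => Lam (f k)); auto.
    + intros k; specialize (H1 k); lia.
    + intros N; destruct (H3 N) as [K HK]; exists K; intros k Hk.
      destruct (HK k Hk) as [He Hf]; split; [lia|].
      apply eqd_lam; apply eqd_le with N; [lia|exact Hf].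
    + apply abc_lam; exact H4.
Qed.

Lemma conv_red_fun n u u' v : abc_term a b c v ->
  conv_red n u u' -> conv_red (n + Nat.b2n b) (App u v) (App u' v).
Proof.
  intros Hv.
  induction 1 as [n u u' H1 H2 H3|n d u u' H1 H2 H3 H4|n e f u H1 _ IH H3 H4].
  - apply conv_refl; try apply abc_app; auto; constructor;
      auto using bisim_refl.
  - apply conv_step with (d + Nat.b2n b); try apply abc_app; auto; [lia|].
    constructor; exact H4.
  - apply conv_lim with (e := fun k => e k + Nat.b2n b)
      (f := fun k => App (f k) v); auto.
    + intros k; specialize (H1 k); lia.
    + intros N; destruct (H3 N) as [K HK]; exists K; intros k Hk.
      destruct (HK k Hk) as [He Hf]; split; [lia|].
      apply eqd_app; [apply eqd_le with N; [lia|exact Hf]|apply eqd_refl].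
    + apply abc_app; auto.
Qed.

Lemma conv_red_arg n u v v' : abc_term a b c u ->
  conv_red n v v' -> conv_red (n + Nat.b2n c) (App u v) (App u v').
Proof.
  intros Hu.
  induction 1 as [n v v' H1 H2 H3|n d v v' H1 H2 H3 H4|n e f v H1 _ IH H3 H4].
  - apply conv_refl; try apply abc_app; auto; constructor;
      auto using bisim_refl.
  - apply conv_step with (d + Nat.b2n c); try apply abc_app; auto; [lia|].
    constructor; exact H4.
  - apply conv_lim with (e := fun k => e k + Nat.b2n c)
      (f := fun k => App u (f k)); auto.
    + intros k; specialize (H1 k); lia.
    + intros N; destruct (H3 N) as [K HK]; exists K; intros k Hk.
      destruct (HK k Hk) as [He Hf]; split; [lia|].
      apply eqd_app; [apply eqd_refl|apply eqd_le with N; [lia|exact Hf]].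
    + apply abc_app; auto.
Qed.

Lemma steps_abc s t :
  steps a b c s t -> abc_term a b c s /\ abc_term a b c t.
Proof. induction 1 as [|d s s' t]; intuition eauto using abc_bisim. Qed.

Lemma steps_conv s t : steps a b c s t -> conv_red 0 s t.
Proof.
  induction 1 as [s t Hs Hst|d s s' t Hs Hss' Hst IH].
  - apply conv_refl; eauto using abc_bisim.
  - apply conv_red_trans with s'; [|exact IH].
    apply conv_step with d; auto; [lia|apply steps_abc in Hst; apply Hst].
Qed.

Section Stages.

Context (lo : trel).
Hypothesis lo_conv : forall s t,
  lo s t -> abc_term a b c s -> abc_term a b c t -> conv_red 0 s t.

Lemma prefix_conv m s t : prefix a b c lo m s t -> conv_red 0 s t.
Proof.
  induction 1 as [s t H|m s s1 t1 t H1 H2 _ IH]; [auto using steps_conv|].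
  apply conv_red_trans with s1; [auto using steps_conv|].
  apply conv_red_trans with t1; [|exact IH].
  apply lo_conv; [exact H2|apply steps_abc in H1; apply H1|].
  apply conv_red_abc in IH; apply IH.
Qed.

(** [stage d s t]: [s] is [t] down to depth [d], where pairs of [red_at]
    remain. *)
Inductive stage : nat -> trel :=
| stage_0 s t :
    abc_term a b c s -> abc_term a b c t -> red_at a b c lo s t -> stage 0 s t
| stage_var d x : stage (S d) (Var x) (Var x)
| stage_lam d u u' :
    stage (S d - Nat.b2n a) u u' -> stage (S d) (Lam u) (Lam u')
| stage_app d u u' v v' :
    stage (S d - Nat.b2n b) u u' -> stage (S d - Nat.b2n c) v v' ->
    stage (S d) (App u v) (App u' v').

Lemma stage_abc d s t : stage d s t -> abc_term a b c s /\ abc_term a b c t.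
Proof.
  induction 1; rewrite ?abc_lam, ?abc_app; intuition auto.
  all: apply abc_intro; intros p w Hw; inversion Hw.
Qed.

Lemma stage_eqd d s t : stage d s t -> eqd a b c d s t.
Proof. induction 1; auto using eqd_0, eqd_refl, eqd_lam, eqd_app. Qed.

Lemma rules_stage :
  (forall s t, red_rules a b c lo (red_at a b c lo) s t ->
     abc_term a b c s -> abc_term a b c t ->
     exists w, conv_red 0 s w /\ stage 1 w t) /\
  (forall s t, lift_rules a b c lo (red_at a b c lo) s t ->
     abc_term a b c s -> abc_term a b c t ->
     exists w, conv_red 0 s w /\ stage 1 w t).
Proof.
  assert (Hchild : forall (d : bool) u u',
    abc_term a b c u -> abc_term a b c u' ->
    (d = true -> red_at a b c lo u u') ->
    (d = false -> abc_term a b c u -> abc_term a b c u' ->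
       exists w, conv_red 0 u w /\ stage 1 w u') ->
    exists w, conv_red 0 u w /\ stage (1 - Nat.b2n d) w u').
  { intros [|] u u' Hu Hu' HX HI; [|auto].
    exists u; split; [apply conv_refl; auto using bisim_refl|].
    apply stage_0; auto. }
  enough (H :
    (forall s t (_ : red_rules a b c lo (red_at a b c lo) s t),
      abc_term a b c s -> abc_term a b c t ->
      exists w, conv_red 0 s w /\ stage 1 w t) /\
    (forall s t (_ : lift_rules a b c lo (red_at a b c lo) s t),
      abc_term a b c s -> abc_term a b c t ->
      exists w, conv_red 0 s w /\ stage 1 w t)) by exact H.
  apply red_lift_rules_ind.
  - intros m s s' t Hpre _ IH Hs Ht; apply prefix_conv in Hpre.
    destruct IH as (w & Hw & Hst); [apply conv_red_abc in Hpre; apply Hpre|auto|].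
    exists w; split; [eapply conv_red_trans; eassumption|exact Hst].
  - intros x Hs _; exists (Var x); split; [|constructor].
    apply conv_refl; auto using bisim_refl.
  - intros u u' HX HR IH Hs Ht; rewrite abc_lam in Hs, Ht.
    destruct (Hchild a u u' Hs Ht HX IH) as (w & Hw & Hst).
    exists (Lam w); split; [|constructor; exact Hst].
    eapply conv_red_le; [|apply conv_red_lam; exact Hw]; lia.
  - intros u u' v v' HX HR IH HX' HR' IH' Hs Ht; rewrite abc_app in Hs, Ht.
    destruct Hs as [Hu Hv], Ht as [Hu' Hv'].
    destruct (Hchild b u u' Hu Hu' HX IH) as (w & Hw & Hst).
    destruct (Hchild c v v' Hv Hv' HX' IH') as (w' & Hw' & Hst').
    exists (App w w'); split; [|constructor; assumption].
    apply conv_red_trans with (App w v).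
    + eapply conv_red_le; [|apply conv_red_fun; eassumption]; lia.
    + apply conv_red_abc in Hw.
      eapply conv_red_le; [|apply conv_red_arg; [apply Hw|exact Hw']]; lia.
Qed.

Lemma stage_next d s t :
  stage d s t -> exists w, conv_red d s w /\ stage (S d) w t.
Proof.
  induction 1 as [s t Hs Ht H|d x|d u u' H IH|d u u' v v' H IH H' IH'].
  - apply (proj1 rules_stage); auto; apply red_atE; exact H.
  - exists (Var x); split; [|constructor].
    apply conv_refl; auto using bisim_refl;
      apply abc_intro; intros p w Hw; inversion Hw.
  - destruct IH as (w & Hw & Hst); exists (Lam w); split.
    + eapply conv_red_le; [|apply conv_red_lam; exact Hw]; lia.
    + constructor; replace (S (S d) - Nat.b2n a) with (S (S d - Nat.b2n a))
        by (destruct a; simpl; lia); exact Hst.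
  - destruct IH as (w & Hw & Hst), IH' as (w' & Hw' & Hst').
    exists (App w w'); split.
    + apply conv_red_trans with (App w v).
      * eapply conv_red_le;
          [|apply conv_red_fun; [apply stage_abc in H'; apply H'|exact Hw]]; lia.
      * eapply conv_red_le;
          [|apply conv_red_arg; [apply stage_abc in Hst; apply Hst|exact Hw']]; lia.
    + constructor.
      * replace (S (S d) - Nat.b2n b) with (S (S d - Nat.b2n b))
          by (destruct b; simpl; lia); exact Hst.
      * replace (S (S d) - Nat.b2n c) with (S (S d - Nat.b2n c))
          by (destruct c; simpl; lia); exact Hst'.
Qed.

Lemma red_at_conv s t :
  red_at a b c lo s t -> abc_term a b c s -> abc_term a b c t -> conv_red 0 s t.
Proof.
  intros H Hs Ht.
  pose (next d (w : {w | stage d w t}) :=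
    constructive_indefinite_description _ (stage_next d _ t (proj2_sig w))).
  pose (f := nat_rect (fun d => {w | stage d w t})
    (exist _ s (stage_0 s t Hs Ht H))
    (fun d w => exist _ (proj1_sig (next d w)) (proj2 (proj2_sig (next d w))))).
  apply (conv_lim 0 (fun k => k) (fun k => proj1_sig (f k)) t); [lia|..|exact Ht].
  - intros k; exact (proj1 (proj2_sig (next k (f k)))).
  - intros N; exists N; intros k Hk; split; [exact Hk|].
    apply eqd_le with k; [exact Hk|]; apply stage_eqd, (proj2_sig (f k)).
Qed.

End Stages.

Lemma lifted_conv {W : wellOrder} (g : W) s t :
  lifted a b c g s t -> abc_term a b c s -> abc_term a b c t -> conv_red 0 s t.
Proof.
  revert s t; induction (olt_wf W g) as [g _ IH]; intros s t H Hs Ht.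
  apply liftedE in H.
  apply (red_at_conv (fun s t => exists d : W, olt d g /\ lifted a b c d s t));
    auto.
  - intros u v (d & Hd & Huv); eauto.
  - apply red_atE; apply split with (m := 0) (s' := s); [|exact H].
    constructor; constructor; auto using bisim_refl.
Qed.

Lemma red_conv {W : wellOrder} (g : W) s t :
  red a b c g s t -> abc_term a b c s -> abc_term a b c t -> conv_red 0 s t.
Proof.
  apply red_at_conv; intros u v (d & _ & Huv); exact (lifted_conv d u v Huv).
Qed.

End Backward.

Section SubOrder.

Context {W : wellOrder} (P : W -> Prop).

Definition sub_lt (x y : {x | P x}) : Prop := olt (proj1_sig x) (proj1_sig y).

Lemma sub_lt_total x y : sub_lt x y \/ x = y \/ sub_lt y x.
Proof.
  destruct x as [x Hx], y as [y Hy]; unfold sub_lt; simpl.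
  destruct (olt_total W x y) as [H|[->|H]]; auto.
  right; left; f_equal; apply proof_irrelevance.
Qed.

Definition sub_order : wellOrder :=
  WellOrder {x | P x} sub_lt
    (wf_inverse_image _ _ _ (@proj1_sig W P) (olt_wf W))
    (fun x y z => olt_trans W _ _ _) sub_lt_total.

End SubOrder.

Section SumOrder.

Context (W : nat -> wellOrder).

Definition sum_elem (k : nat) (x : W k) : option {k & W k} :=
  Some (existT (fun k => carrier (W k)) k x).

(** The sum of the [W k], with a greatest element [None] added. *)
Inductive sum_lt : option {k & W k} -> option {k & W k} -> Prop :=
| sum_lt_index k l x y :
    k < l -> sum_lt (sum_elem k x) (sum_elem l y)
| sum_lt_in k x y :
    olt x y -> sum_lt (sum_elem k x) (sum_elem k y)
| sum_lt_top p : sum_lt (Some p) None.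

Lemma sum_lt_inv k l x y :
  sum_lt (sum_elem k x) (sum_elem l y) ->
  k < l \/ exists e : k = l, olt (eq_rect k (fun i => W i) x l e) y.
Proof.
  remember (sum_elem k x) as p eqn:Hp; remember (sum_elem l y) as q eqn:Hq.
  intros H; destruct H as [i j x' y' Hij|i x' y' Hxy|r];
    unfold sum_elem in Hp, Hq; try discriminate.
  - injection Hp as <- _; injection Hq as <- _; auto.
  - right; injection Hp as <- Hx; injection Hq as <- Hy.
    exists eq_refl; simpl.
    apply (Eqdep_dec.inj_pair2_eq_dec _ Nat.eq_dec) in Hx, Hy; subst; exact Hxy.
Qed.

Lemma sum_lt_in_inv k x y :
  sum_lt (sum_elem k x) (sum_elem k y) -> olt x y.
Proof.
  intros H; apply sum_lt_inv in H as [H|[e H]]; [lia|].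
  rewrite <- (Eqdep_dec.eq_rect_eq_dec Nat.eq_dec) in H; exact H.
Qed.

Lemma sum_lt_Some_inv p k y :
  sum_lt p (sum_elem k y) ->
  exists l x, p = sum_elem l x /\ l <= k.
Proof. inversion 1; subst; do 2 eexists; split; eauto; lia. Qed.

Lemma sum_lt_wf : well_founded sum_lt.
Proof.
  assert (HS : forall k x, Acc sum_lt (sum_elem k x)).
  { intros k; induction k as [k IHk] using lt_wf_ind.
    intros x; induction (olt_wf (W k) x) as [x _ IHx].
    constructor; intros p Hp.
    destruct (sum_lt_Some_inv _ _ _ Hp) as (l & y & -> & Hl).
    destruct (Nat.eq_dec l k) as [->|Hlk]; [|apply IHk; lia].
    apply IHx, sum_lt_in_inv, Hp. }
  intros [[k x]|]; [apply HS|].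
  constructor; intros [[k x]|] Hp; [apply HS|inversion Hp].
Qed.

Lemma sum_lt_trans p q r : sum_lt p q -> sum_lt q r -> sum_lt p r.
Proof.
  destruct r as [[m z]|]; [|destruct 1; constructor].
  intros Hpq Hqr.
  destruct (sum_lt_Some_inv _ _ _ Hqr) as (l & y & -> & Hl).
  destruct (sum_lt_Some_inv _ _ _ Hpq) as (k & x & -> & Hk).
  destruct (Nat.eq_dec k m) as [->|Hkm]; [|constructor; lia].
  assert (l = m) by lia; subst l; apply sum_lt_in_inv in Hpq, Hqr.
  apply sum_lt_in; eauto using olt_trans.
Qed.

Lemma sum_lt_total p q : sum_lt p q \/ p = q \/ sum_lt q p.
Proof.
  destruct p as [[k x]|], q as [[l y]|]; auto using sum_lt_top.
  destruct (lt_eq_lt_dec k l) as [[H|<-]|H].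
  - left; apply sum_lt_index; exact H.
  - destruct (olt_total _ x y) as [H|[->|H]].
    + left; apply sum_lt_in; exact H.
    + right; left; reflexivity.
    + right; right; apply sum_lt_in; exact H.
  - right; right; apply sum_lt_index; exact H.
Qed.

Definition sum_order : wellOrder :=
  WellOrder _ sum_lt sum_lt_wf sum_lt_trans sum_lt_total.

Notation inj k x := (sum_elem k x : sum_order).

Lemma sum_ole_index k l x y : ole (inj k x) (inj l y) -> k <= l.
Proof.
  intros H; apply Nat.nlt_ge; intros Hlk.
  exact (olt_not_ole (inj l y) (inj k x) (sum_lt_index _ _ _ _ Hlk) H).
Qed.

Lemma sum_ole_in_inv k x y : ole (inj k x) (inj k y) -> ole x y.
Proof.
  intros H; destruct (olt_or_ole y x) as [Hyx|Hxy]; [|exact Hxy].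
  destruct (olt_not_ole (inj k y) (inj k x) (sum_lt_in _ _ _ Hyx) H).
Qed.

Context (o g : forall k, W k).
Hypothesis o_zero : forall k, is_zero (o k).
Hypothesis g_max : forall k x, ole x (g k).

Lemma sum_succ_in k x y : is_succ x y -> is_succ (inj k x) (inj k y).
Proof.
  intros [Hxy Hy]; split; [constructor; exact Hxy|].
  intros [[l z]|] H; [|left; constructor].
  destruct (Nat.eq_dec k l) as [<-|Hl].
  - apply sum_lt_in_inv in H; destruct (Hy z H) as [H'|<-];
      [left; constructor; exact H'|right; reflexivity].
  - apply sum_lt_inv in H as [H|[e _]]; [left; constructor; exact H|lia].
Qed.

Lemma sum_succ_next k : is_succ (inj k (g k)) (inj (S k) (o (S k))).
Proof.
  split; [constructor; lia|].
  intros [[l z]|] H; [|left; constructor].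
  destruct (sum_lt_inv _ _ _ _ H) as [Hkl|[<- H']].
  - destruct (Nat.eq_dec l (S k)) as [->|Hl]; [|left; constructor; lia].
    destruct (zero_ole _ z (o_zero (S k))) as [Hz|<-];
      [left; constructor; exact Hz|right; reflexivity].
  - simpl in H'; destruct (olt_not_ole _ _ H' (g_max k z)).
Qed.

Lemma sum_zero : is_zero (inj 0 (o 0)).
Proof.
  intros p Hp; destruct (sum_lt_Some_inv _ _ _ Hp) as (l & z & -> & Hl).
  destruct l; [|lia]; apply sum_lt_in_inv in Hp; exact (o_zero 0 z Hp).
Qed.

Lemma sum_top_ole (p : sum_order) : ole p (None : sum_order).
Proof. destruct p; [left; constructor|right; reflexivity]. Qed.

Lemma sum_succ_inv k x p : is_succ (inj k x) p ->
  (exists y, p = inj k y /\ is_succ x y) \/ (x = g k /\ p = inj (S k) (o (S k))).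
Proof.
  intros Hp; destruct (g_max k x) as [Hx| ->].
  - destruct (exists_succ x (g k) Hx) as (y & Hy & _); left; exists y.
    split; [|exact Hy]; exact (is_succ_inj _ _ _ Hp (sum_succ_in k x y Hy)).
  - right; split; [reflexivity|].
    exact (is_succ_inj _ _ _ Hp (sum_succ_next k)).
Qed.

Lemma sum_limit_inv k x : is_limit (inj k x) -> is_limit x.
Proof.
  intros [H0 HS]; split.
  - intros Hx; assert (x = o k) as ->.
    { apply ole_antisym; apply zero_ole; auto. }
    destruct k as [|k]; [exact (H0 sum_zero)|exact (HS _ (sum_succ_next k))].
  - intros y Hy; exact (HS _ (sum_succ_in k y x Hy)).
Qed.

End SumOrder.

Record gseq_pack (a b c : bool) (n : nat) (s t : raw_term) : Type := {
  gp_order : wellOrder;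
  gp_o : gp_order;
  gp_g : gp_order;
  gp_T : gp_order -> raw_term;
  gp_D : gp_order -> nat;
  gp_zero : is_zero gp_o;
  gp_max : forall x, ole x gp_g;
  gp_gseq : gseq a b c gp_o gp_g gp_T gp_D;
  gp_depth : forall x, n <= gp_D x;
  gp_start : bisim s (gp_T gp_o);
  gp_end : bisim (gp_T gp_g) t
}.

Lemma bool_order_wf : well_founded (fun x y : bool => x = false /\ y = true).
Proof.
  assert (H : Acc (fun x y : bool => x = false /\ y = true) false).
  { constructor; intros x [_ H]; discriminate. }
  intros [|]; [|exact H]; constructor; intros x [-> _]; exact H.
Qed.

Definition bool_order : wellOrder.
Proof.
  refine (WellOrder bool (fun x y => x = false /\ y = true) bool_order_wf _ _);
    intros [|] [|]; intuition congruence.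
Defined.

Lemma single_gseq a b c n s t :
  abc_term a b c s -> abc_term a b c t ->
  bisim s t \/ step a b c n s t -> gseq_pack a b c n s t.
Proof.
  intros Hs Ht H.
  apply (Build_gseq_pack a b c n s t bool_order false true
           (fun x : bool => if x then t else s) (fun _ => n));
    auto using bisim_refl.
  - intros y [_ Hy]; discriminate.
  - intros [|]; [right|left]; simpl; auto.
  - split.
    + intros [|] _ _; assumption.
    + intros z z' _ [-> _] [[_ ->] _]; exact H.
    + intros [|] _ _ [H0 HS] N.
      * destruct (HS false); split; [split; reflexivity|].
        intros z [_ ->]; right; reflexivity.
      * destruct H0; intros y [_ Hy]; discriminate.
Qed.

Lemma lim_gseq a b c n (e : nat -> nat) (f : nat -> raw_term) t :
  (forall k, n <= e k) -> (forall k, gseq_pack a b c (e k) (f k) (f (S k))) ->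
  (forall N, exists K, forall k, K <= k -> N <= e k /\ eqd a b c N (f k) t) ->
  abc_term a b c t -> gseq_pack a b c n (f 0) t.
Proof.
  intros He G Hlim Ht.
  pose (W k := gp_order _ _ _ _ _ _ (G k)).
  pose (o k := gp_o _ _ _ _ _ _ (G k) : W k).
  pose (g k := gp_g _ _ _ _ _ _ (G k) : W k).
  assert (Ho : forall k, is_zero (o k)) by (intros; apply gp_zero).
  assert (Hg : forall k x, ole x (g k)) by (intros; apply gp_max).
  assert (HG : forall k, gseq a b c (o k) (g k) (gp_T _ _ _ _ _ _ (G k))
                           (gp_D _ _ _ _ _ _ (G k))) by (intros; apply gp_gseq).
  pose (T (p : sum_order W) := match p with
    | Some (existT k x) => gp_T _ _ _ _ _ _ (G k) x
    | None => t end).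
  pose (D (p : sum_order W) := match p with
    | Some (existT k x) => gp_D _ _ _ _ _ _ (G k) x
    | None => n end).
  apply (Build_gseq_pack a b c n (f 0) t (sum_order W)
           (sum_elem W 0 (o 0)) None T D).
  - apply sum_zero; exact Ho.
  - apply sum_top_ole.
  - split.
    + intros [[k x]|] _ _; [|exact Ht].
      apply (gs_term _ _ _ _ _ _ _ (HG k)); auto using zero_ole.
    + intros [[k x]|] p _ Hp Hs; [|inversion Hp].
      destruct (sum_succ_inv W o g Ho Hg k x p Hs) as [(y & -> & Hy)|[-> ->]].
      * apply (gs_step _ _ _ _ _ _ _ (HG k)); auto using zero_ole.
        eapply olt_ole_trans; [apply Hy|apply Hg].
      * left; apply bisim_trans with (f (S k)); [apply gp_end|apply gp_start].
    + intros [[k x]|] _ _ Hl N.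
      * apply (sum_limit_inv W o g Ho Hg) in Hl.
        destruct (gs_limit _ _ _ _ _ _ _ (HG k) x) with (N := N)
          as (z0 & _ & Hz0 & H); auto.
        { destruct (zero_ole _ x (Ho k)) as [Hx|Hx]; [exact Hx|].
          rewrite <- Hx in Hl; destruct (proj1 Hl (Ho k)). }
        exists (sum_elem W k z0 : sum_order W); split; [|split].
        -- apply zero_ole, sum_zero, Ho.
        -- constructor; exact Hz0.
        -- intros p Hp Hpx.
           destruct (sum_lt_Some_inv _ _ _ _ Hpx) as (l & z & -> & Hlk).
           assert (l = k) as ->.
           { apply sum_ole_index in Hp; lia. }
           apply (H z); [exact (sum_ole_in_inv _ _ _ _ Hp)|].
           exact (sum_lt_in_inv _ _ _ _ Hpx).
      * destruct (Hlim N) as [K HK].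
        exists (sum_elem W K (o K) : sum_order W); split; [|split].
        -- apply zero_ole, sum_zero, Ho.
        -- constructor.
        -- intros [[k z]|] Hp Hz; [|inversion Hz].
           assert (Hk : K <= k) by exact (sum_ole_index _ _ _ _ _ Hp).
           destruct (HK k Hk) as [HN Hf].
           split; [|simpl; etransitivity; [exact HN|apply gp_depth]].
           apply eqd_trans with (f k); [|exact Hf]; apply eqd_sym.
           apply (gseq_ind _ _ _ _ _ _ _ (fun u => eqd a b c N (f k) u) N (HG k));
             auto using zero_ole; [apply bisim_eqd, gp_start| |].
           ++ intros z' z'' Hz' Hzg Hs Hfz; apply eqd_trans with (1 := Hfz).
              destruct (gs_step _ _ _ _ _ _ _ (HG k) z' z'' Hz' Hzg Hs) as [H|H];
                [apply bisim_eqd; exact H|].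
              eapply eqd_le; [|exact (step_eqd _ _ _ _ _ _ H)].
              etransitivity; [exact HN|apply gp_depth].
           ++ intros u v Huv Hu; eapply eqd_trans; eassumption.
  - intros [[k x]|]; simpl; [|lia].
    etransitivity; [apply (He k)|apply gp_depth].
  - apply gp_start.
  - apply bisim_refl.
Qed.

Lemma gseq_pack_le a b c m n s t :
  m <= n -> gseq_pack a b c n s t -> gseq_pack a b c m s t.
Proof.
  intros Hmn G; eapply (Build_gseq_pack a b c m s t); try apply G.
  intros x; etransitivity; [exact Hmn|apply G].
Qed.

Lemma conv_red_gseq a b c n s t :
  conv_red a b c n s t -> inhabited (gseq_pack a b c n s t).
Proof.
  induction 1 as [n s t Hs Ht H|n d s t Hn Hs Ht H|n e f t He _ IH Hlim Ht].
  - constructor; apply single_gseq; auto.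
  - constructor; apply gseq_pack_le with d; [exact Hn|]; apply single_gseq; auto.
  - constructor; apply lim_gseq with e; auto.
    intros k; apply epsilon; [apply IH|intros; exact True].
Qed.

Section Stutter.

Context (a b c : bool) {W : wellOrder} (o g : W).
Context (T : W -> raw_term) (D : W -> nat).
Hypothesis o_zero : is_zero o.
Hypothesis g_max : forall x, ole x g.
Hypothesis T_gseq : gseq a b c o g T D.

Definition proper (x : W) : Prop :=
  x = g \/ exists x', is_succ x x' /\ ~ bisim (T x) (T x').

Lemma stutter_bisim x y :
  ole x y -> (forall z, ole x z -> olt z y -> ~ proper z) -> bisim (T x) (T y).
Proof.
  intros Hxy Hn; apply (eqd_bisim a b c); intros d.
  assert (HT : gseq a b c x y T D).
  { eapply gseq_sub; [exact T_gseq|apply zero_ole, o_zero|apply g_max]. }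
  apply (gseq_ind _ _ _ _ _ _ _ (fun u => eqd a b c d (T x) u) d HT);
    auto using ole_refl.
  - apply eqd_refl.
  - intros z z' Hxz Hzy Hs Hz; apply eqd_trans with (1 := Hz), bisim_eqd.
    apply NNPP; intros Hb; apply (Hn z Hxz Hzy); right; eauto.
  - intros u v Huv Hu; eapply eqd_trans; eassumption.
Qed.

Notation W' := (sub_order proper).

(** A limit of [W'] need not be one in [W], but it is reached by stuttering
    from a limit [u] of [W]. *)
Lemma proper_limit (l : W') N : is_limit l ->
  exists x0 : W', olt x0 l /\ forall x : W', ole x0 x -> olt x l ->
    eqd a b c N (T (proj1_sig x)) (T (proj1_sig l)) /\ N <= D (proj1_sig x).
Proof.
  destruct l as [l Pl]; intros [H0 HS].
  destruct (exists_min (fun u => ole u l /\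
    forall z, ole u z -> olt z l -> ~ proper z) l)
    as (u & [Hul Hu] & _ & Hm).
  { split; [apply ole_refl|]; intros z H1 H2; destruct (olt_not_ole _ _ H2 H1). }
  assert (Hbelow : forall z, olt z u ->
            exists x : W', ole z (proj1_sig x) /\ olt (proj1_sig x) u).
  { intros z Hz; apply NNPP; intros Hn.
    apply (olt_not_ole z u Hz), Hm; split; [left; eapply olt_ole_trans; eassumption|].
    intros x Hzx Hxl Px; destruct (olt_or_ole x u) as [Hxu|Hux].
    - apply Hn; exists (exist _ x Px); auto.
    - exact (Hu x Hux Hxl Px). }
  assert (Hlt : forall x : W', olt x (exist _ l Pl : W') -> olt (proj1_sig x) u).
  { intros [x Px] Hx; destruct (olt_or_ole x u) as [Hxu|Hux]; [exact Hxu|].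
    destruct (Hu x Hux Hx Px). }
  assert (Hgt : forall x : W', olt (proj1_sig x) u -> olt x (exist _ l Pl : W')).
  { intros [x Px] Hx; exact (olt_ole_trans _ _ _ Hx Hul). }
  destruct (zero_succ_limit u) as [Hz|[[w Hw]|Hlim]].
  - destruct H0; intros x Hx; exact (Hz _ (Hlt x Hx)).
  - destruct (Hbelow w (proj1 Hw)) as (x & Hwx & Hxu).
    destruct (HS x); split; [exact (Hgt x Hxu)|].
    intros z Hxz; destruct (olt_or_ole z (exist _ l Pl : W')) as [Hzl|Hlz];
      [|exact Hlz].
    assert (Hzw := succ_ole _ _ _ Hw (Hlt z Hzl)).
    destruct (olt_not_ole (proj1_sig x) (proj1_sig z) Hxz).
    eapply ole_trans; eassumption.
  - assert (Hou : olt o u).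
    { destruct (zero_ole _ u o_zero) as [H|<-]; [exact H|].
      destruct (proj1 Hlim o_zero). }
    destruct (gs_limit _ _ _ _ _ _ _ T_gseq u Hou (g_max u) Hlim N)
      as (z0 & _ & Hz0 & H).
    destruct (Hbelow z0 Hz0) as (x0 & Hzx & Hx0).
    exists x0; split; [exact (Hgt x0 Hx0)|]; intros x Hx Hxl.
    destruct (H (proj1_sig x)) as [HE HD].
    + destruct Hx as [Hx| <-]; [|exact Hzx].
      exact (olt_ole _ _ (ole_olt_trans _ _ _ Hzx Hx)).
    + exact (Hlt x Hxl).
    + split; [|exact HD]; apply eqd_trans with (1 := HE), bisim_eqd.
      apply stutter_bisim; assumption.
Qed.

Lemma gseq_sc_red s t : bisim s (T o) -> bisim (T g) t -> sc_red a b c s t.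
Proof.
  intros Hs Ht.
  assert (Pg : proper g) by (left; reflexivity).
  destruct (exists_min (fun x : W' => True) (exist _ g Pg))
    as ([o1 Po1] & _ & _ & Hmin); [exact I|].
  assert (Hz : is_zero (exist _ o1 Po1 : W')).
  { intros x Hx; exact (olt_not_ole _ _ Hx (Hmin x I)). }
  exists W', (exist _ o1 Po1), (exist _ g Pg),
    (fun x : W' => T (proj1_sig x)), (fun x : W' => D (proj1_sig x)).
  split; [split|split; [exact Hz|split; [|exact Ht]]].
  - intros x _; apply (gs_term _ _ _ _ _ _ _ T_gseq); auto using zero_ole.
  - intros [x Px] [y Py] Hx [Hxy Hy]; unfold olt in Hx, Hxy; simpl in *.
    destruct Px as [->|(x' & Hx' & Hb)]; [destruct (olt_irrefl _ Hx)|].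
    apply step_bisim with (T x) (T x'); [apply bisim_refl| |].
    + destruct (gs_step _ _ _ _ _ _ _ T_gseq x x' (zero_ole _ _ o_zero) Hx Hx')
        as [H|H]; [contradiction|exact H].
    + apply stutter_bisim; [apply Hx', Hxy|].
      intros z Hxz Hzy Pz.
      destruct (Hy (exist _ z Pz)) as [H|H].
      * exact (olt_ole_trans _ _ _ (proj1 Hx') Hxz).
      * destruct (olt_not_ole _ _ Hzy); left; exact H.
      * injection H as ->; destruct (olt_irrefl _ Hzy).
  - intros l _ Hl eps Heps; destruct (pow_half_lt eps Heps) as [N HN].
    destruct (proper_limit l N Hl) as (x0 & Hx0 & H).
    exists x0; split; [exact Hx0|]; intros x Hx Hxl.
    eapply Rle_lt_trans; [apply eqd_dist_le, (H x Hx Hxl)|exact HN].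
  - intros l _ Hl N; destruct (proper_limit l N Hl) as (x0 & Hx0 & H).
    exists x0; split; [exact Hx0|]; intros x Hx Hxl; apply (H x Hx Hxl).
  - simpl; apply bisim_trans with (1 := Hs), stutter_bisim;
      [apply zero_ole, o_zero|].
    intros z _ Hz1 Pz; exact (Hz (exist _ z Pz) Hz1).
Qed.

End Stutter.

Theorem theorem2p11 (a b c : bool) (s t : raw_term)
    (hs : abc_term a b c s) (ht : abc_term a b c t) :
  sc_red a b c s t <->
  exists (W : wellOrder) (g : W), below_omega1 g /\ red a b c g s t.
Proof.
  split; [apply sc_red_red; assumption|].
  intros (W & g & _ & H); apply red_conv in H; [|exact hs|exact ht].
  destruct (conv_red_gseq _ _ _ _ _ _ H) as [G].
  eapply gseq_sc_red; apply G.
Qed.
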